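(* Let $E,E_1,\dots,E_n$ ($n\ge1$) be $\mathcal{E}$-formulas over $L$. (1) If $E_1\prec E,\dots,E_n\prec E$, then $E_1\vee\dots\vee E_n\prec E$. (2) If $E\approx E_1\vee\dots\vee E_n$, then $E\approx E_j$ for some $j$. (3) If $E\preceq E_1\vee\dots\vee E_n$, then $E\preceq E_j$ for some $j$.
   Context: $L$ is a first-order language with equality whose function symbols include at least one constant. $\mathrm{FEA}(L)$ (free equality axioms): $f(x_1,\dots,x_n)=f(y_1,\dots,y_n)\leftrightarrow x_1=y_1\wedge\dots\wedge x_n=y_n$ for each $n$-ary $f$; $f(\bar x)=g(\bar y)\leftrightarrow\mathit{False}$ for distinct function symbols $f,g$; $x=t\leftrightarrow\mathit{False}$ whenever $x\not\equiv t$ and $x$ occurs in $t$. An $\mathcal{E}$-formula is a formula built from $\mathit{True}$, $\mathit{False}$ and equations using only $\wedge$ and $\exists$. An equational formula is any formula whose only atomic subformulas are equations and propositional constants. For equational formulas $F,F'$ over $L$: $F\preceq F'$ iff $\mathrm{FEA}(L)\models F\rightarrow F'$; $F\approx F'$ iff $\mathrm{FEA}(L)\models F\leftrightarrow F'$; $F\prec F'$ iff $F\preceq F'$ and not $F\approx F'$. *)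

(* Defs.v *)
From mathcomp Require Import all_boot.

Set Implicit Arguments.
Unset Strict Implicit.
Unset Printing Implicit Defensive.

Record language : Type := Language {
  funsym : Type;
  fun_arity : funsym -> nat;
  predsym : Type;
  pred_arity : predsym -> nat
}.

(* (T ^ n)%type is {ffun 'I_n -> T}; constants are the symbols of arity 0. *)
Inductive term (L : language) : Type :=
| Var of nat
| App (f : funsym L) of (term L ^ fun_arity f)%type.

Inductive formula (L : language) : Type :=
| FTrue
| FFalse
| Eqn of term L & term L
| Pred (p : predsym L) of (term L ^ pred_arity p)%type
| Not of formula L
| And of formula L & formula L
| Or of formula L & formula L
| Imp of formula L & formula L
| Iff of formula L & formula L
| All of nat & formula L
| Ex of nat & formula L.

Arguments Var {L}.
Arguments App {L}.
Arguments FTrue {L}.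
Arguments FFalse {L}.
Arguments Pred {L}.

(* Nonemptiness of the carrier is not a field: it follows from the presence of
   a constant in the language. *)
Record structure (L : language) : Type := Structure {
  carrier :> Type;
  finterp : forall f : funsym L, (carrier ^ fun_arity f)%type -> carrier;
  pinterp : forall p : predsym L, (carrier ^ pred_arity p)%type -> Prop
}.

Section Semantics.
Variables (L : language) (M : structure L).

Fixpoint eval (rho : nat -> M) (t : term L) : M :=
  match t with
  | Var x => rho x
  | App f a => finterp [ffun i => eval rho (a i)]
  end.

Definition update (rho : nat -> M) (x : nat) (m : M) : nat -> M :=
  fun y => if y == x then m else rho y.

Fixpoint sat (rho : nat -> M) (F : formula L) : Prop :=
  match F with
  | FTrue => True
  | FFalse => False
  | Eqn s t => eval rho s = eval rho t
  | Pred p a => pinterp [ffun i => eval rho (a i)]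
  | Not G => ~ sat rho G
  | And G H => sat rho G /\ sat rho H
  | Or G H => sat rho G \/ sat rho H
  | Imp G H => sat rho G -> sat rho H
  | Iff G H => sat rho G <-> sat rho H
  | All x G => forall m : M, sat (update rho x m) G
  | Ex x G => exists m : M, sat (update rho x m) G
  end.

(* Truth of the universal closure. *)
Definition valid (F : formula L) : Prop := forall rho : nat -> M, sat rho F.

End Semantics.

Definition entails (L : language) (T : formula L -> Prop) (F : formula L) :
    Prop :=
  forall M : structure L, (forall G, T G -> valid M G) -> valid M F.

Section Syntax.
Variable L : language.

Fixpoint occurs (x : nat) (t : term L) : bool :=
  match t with
  | Var y => x == y
  | App f a => [exists i, occurs x (a i)]
  end.

Fixpoint bigconj (s : seq (formula L)) : formula L :=
  match s with
  | [::] => FTrue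
  | [:: F] => F
  | F :: s' => And F (bigconj s')
  end.

Fixpoint bigdisj (s : seq (formula L)) : formula L :=
  match s with
  | [::] => FFalse
  | [:: F] => F
  | F :: s' => Or F (bigdisj s')
  end.

(* f(v_k, ..., v_(k+n-1)) for f of arity n, where v_i is the variable i. *)
Definition app_vars (k : nat) (f : funsym L) : term L :=
  App f [ffun i : 'I_(fun_arity f) => Var (k + i)].

Inductive FEA : formula L -> Prop :=
| FEA_inj (f : funsym L) :
    FEA (Iff (Eqn (app_vars 0 f) (app_vars (fun_arity f) f))
             (bigconj [seq Eqn (Var (nat_of_ord i)) (Var (fun_arity f + i))
                   | i <- enum 'I_(fun_arity f)]))
| FEA_clash (f g : funsym L) : f <> g ->
    FEA (Iff (Eqn (app_vars 0 f) (app_vars (fun_arity f) g)) FFalse)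
| FEA_occurs (x : nat) (t : term L) : t <> Var x -> occurs x t ->
    FEA (Iff (Eqn (Var x) t) FFalse).

Fixpoint Eformula (F : formula L) : bool :=
  match F with
  | FTrue | FFalse | Eqn _ _ => true
  | And G H => Eformula G && Eformula H
  | Ex _ G => Eformula G
  | _ => false
  end.

(* These relations make sense for all formulas; only their restriction to
   equational formulas is of interest. *)
Definition preceq (F G : formula L) : Prop := entails FEA (Imp F G).
Definition approx (F G : formula L) : Prop := entails FEA (Iff F G).
Definition prec (F G : formula L) : Prop := preceq F G /\ ~ approx F G.

End Syntax.

(* Main.v *)
Require Import Defs.
From mathcomp Require Import all_boot.
From Stdlib Require Import Classical FunctionalExtensionality Eqdep.

Set Implicit Arguments.
Unset Strict Implicit.
Unset Printing Implicit Defensive.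

(* A satisfiable E-formula E has a most general solution: an assignment of
   terms to variables that satisfies E in the algebra of all terms (with
   variables), a model of FEA, and through which every solution of E in every
   model of FEA factors.  If E implies a disjunction of E-formulas, then some
   disjunct holds at this generic solution.  Being positive existential, that
   disjunct is preserved by the homomorphisms from the term algebra, so it
   holds at all solutions of E. *)

(** * The term algebra and its substitutions *)

Section TermAlgebra.
Variable L : language.
Implicit Types (f g : funsym L) (s t u : term L) (M : structure L).

(** The induction hypothesis reaches the arguments stored inside the finite function, since each
    [a i] is structurally smaller than [App f a]. *)
Lemma nested_term_ind (P : term L -> Prop) :
  (forall x, P (Var x)) ->
  (forall f (a : (term L ^ fun_arity f)%type),
     (forall i, P (a i)) -> P (App f a)) ->
  forall t, P t.
Proof.
move=> PV PA; fix IH 1 => -[x|f a]; first exact: PV.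
by apply: PA => i; apply: IH.
Qed.

Definition term_structure : structure L :=
  @Structure L (term L) (@App L) (fun _ _ => False).

(* In the term algebra, assignments are substitutions. *)
Notation subst := (@eval L term_structure).

Lemma App_inj f (a b : (term L ^ fun_arity f)%type) :
  App f a = App f b -> a = b.
(* Injectivity of the constructor yields an equality of dependent pairs over [f]. As [funsym L] is
   an arbitrary type, the axiom behind [inj_pair2] removes the index. *)
Proof. by case=> eq_ab; apply: inj_pair2 eq_ab. Qed.

Lemma eq_eval M (rho rho' : nat -> M) t :
  (forall x, occurs x t -> rho x = rho' x) -> eval rho t = eval rho' t.
Proof.
elim/nested_term_ind: t => [x|f a IH] /= eq_rho; first exact: eq_rho.
congr finterp; apply/ffunP => i; rewrite !ffunE; apply: IH => x xai.
by apply: eq_rho; apply/existsP; exists i.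
Qed.

Lemma subst_Var t : subst Var t = t.
Proof.
elim/nested_term_ind: t => [//|f a IH] /=.
by congr App; apply/ffunP => i; rewrite ffunE.
Qed.

Lemma eval_subst M (rho : nat -> M) (theta : nat -> term L) t :
  eval rho (subst theta t) = eval (eval rho \o theta) t.
Proof.
elim/nested_term_ind: t => [//|f a IH] /=.
by congr finterp; apply/ffunP => i; rewrite !ffunE.
Qed.

Lemma occurs_subst x (theta : nat -> term L) t :
  occurs x (subst theta t) -> exists2 y, occurs y t & occurs x (theta y).
Proof.
elim/nested_term_ind: t => [y|f a IH] /=; first by exists y.
case/existsP => i; rewrite ffunE => /IH [y yai xy].
by exists y => //; apply/existsP; exists i.
Qed.

Fixpoint term_size t : nat :=
  match t with
  | Var _ => 1
  | App f a => (\sum_(i < fun_arity f) term_size (a i)).+1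
  end.

(** Here [t] has a root symbol above [x], which adds at least one to the size. This makes the occurs
    axioms true in the term algebra. *)
Lemma term_size_occurs x (theta : nat -> term L) t :
  occurs x t -> t <> Var x -> term_size (theta x) < term_size (subst theta t).
Proof.
elim/nested_term_ind: t => [y|f a IH] /=; first by move/eqP=> ->.
case/existsP => i xai _; rewrite ltnS (bigD1 i) //= ffunE.
apply: leq_trans (leq_addr _ _).
case: (classic (a i = Var x)) => [->|ne] //.
by apply: ltnW; apply: IH.
Qed.

Lemma sat_bigconj M (rho : nat -> M) (I : eqType) (F : I -> formula L)
    (r : seq I) :
  sat rho (bigconj [seq F i | i <- r]) <-> forall i, i \in r -> sat rho (F i).
Proof.
elim: r => [|i [|j r] IH] //=.
  by split=> [Fi k|]; [rewrite inE => /eqP-> | apply; rewrite inE].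
split=> [[Fi /IH Fr] k|Fr].
  by rewrite inE => /orP[/eqP->|/Fr].
split; first by apply: Fr; rewrite inE eqxx.
by apply/IH => k kr; apply: Fr; rewrite inE kr orbT.
Qed.

Lemma sat_bigdisj M (rho : nat -> M) (I : eqType) (F : I -> formula L)
    (r : seq I) :
  sat rho (bigdisj [seq F i | i <- r]) <->
  exists2 i, i \in r & sat rho (F i).
Proof.
elim: r => [|i [|j r] IH] /=; first by split=> // -[].
  by split=> [Fi|[k]]; [exists i; rewrite ?inE | rewrite inE => /eqP->].
split=> [[Fi|/IH[k kr Fk]]|[k]].
- by exists i; rewrite ?inE ?eqxx.
- by exists k; rewrite // inE kr orbT.
by rewrite inE => /orP[/eqP->|kr Fk]; [left | right; apply/IH; exists k].
Qed.

(** * Models of the free equality axioms *)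

Definition FEA_model M := forall G, FEA G -> valid M G.

Section TwoBlocks.
Variables (M : structure L) (d : M) (m n : nat).
Variables (a : (M ^ m)%type) (b : (M ^ n)%type).

(** An assignment under which [app_vars 0 f] and [app_vars (fun_arity f) g] take arbitrary argument
    tuples [a] and [b]; it turns the axioms, stated with fixed variables, into facts about all
    tuples. Variables beyond both blocks get the default [d]. *)
Definition two_blocks (k : nat) : M :=
  if insub k is Some i then a i
  else if insub (k - m) is Some j then b j else d.

Lemma two_blocksl (i : 'I_m) : two_blocks i = a i.
Proof. by rewrite /two_blocks valK. Qed.

Lemma two_blocksr (j : 'I_n) : two_blocks (m + j) = b j.
Proof. by rewrite /two_blocks insubN ?ltnNge ?leq_addr // addKn valK. Qed.

End TwoBlocks.

Lemma FEA_model_inj M f (a b : (M ^ fun_arity f)%type) :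
  FEA_model M -> finterp a = finterp b -> a = b.
Proof.
move=> HM eq_ab; apply/ffunP => i.
have /= [H _] := HM _ (FEA_inj f) (two_blocks (finterp a) a b).
rewrite -(two_blocksl (finterp a) a b) -(two_blocksr (finterp a) a b).
have /H /sat_bigconj : finterp [ffun i => eval (two_blocks (finterp a) a b)
    ([ffun i : 'I_(fun_arity f) => Var (0 + i)] i)] =
  finterp [ffun i => eval (two_blocks (finterp a) a b)
    ([ffun i : 'I_(fun_arity f) => Var (fun_arity f + i)] i)].
  transitivity (finterp a); last rewrite eq_ab; congr finterp;
    by apply/ffunP => j; rewrite !ffunE /= ?two_blocksl ?two_blocksr.
by apply; rewrite mem_enum.
Qed.

Lemma FEA_model_clash M f g (a : (M ^ fun_arity f)%type)
    (b : (M ^ fun_arity g)%type) :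
  FEA_model M -> finterp a = finterp b -> f = g.
Proof.
move=> HM eq_ab; apply: NNPP => fg.
have /= [H _] := HM _ (FEA_clash fg) (two_blocks (finterp a) a b).
apply: H; transitivity (finterp a); last rewrite eq_ab; congr finterp;
  by apply/ffunP => j; rewrite !ffunE /= ?two_blocksl ?two_blocksr.
Qed.

Lemma FEA_model_occurs M (rho : nat -> M) x t :
  FEA_model M -> t <> Var x -> rho x = eval rho t -> ~~ occurs x t.
Proof.
move=> HM tx eq_xt; apply/negP => xt.
by have /= [H _] := HM _ (FEA_occurs tx xt) rho; apply: H.
Qed.

(** Constructors are injective and disjoint, and a size comparison rules out cyclic equations. *)
Lemma FEA_model_term : FEA_model term_structure.
Proof.
move=> _ [f|f g fg|x t tx xt] theta /=; split=> //.
- move/App_inj/ffunP => eq_ab; apply/sat_bigconj => i _ /=.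
  by have := eq_ab i; rewrite !ffunE.
- move/sat_bigconj => eq_ab; congr App; apply/ffunP => i; rewrite !ffunE /=.
  by apply: eq_ab; rewrite mem_enum.
- by case.
- move=> eq_xt; have := term_size_occurs theta xt tx.
  by rewrite -eq_xt ltnn.
Qed.

(** * Most general solutions of constraints *)

Definition constraint := forall M, (nat -> M) -> Prop.

(** The map [eval rho] is the homomorphism from the term algebra to [M] that extends [rho], so this
    is preservation under such homomorphisms. *)
Definition hom_stable (C : constraint) :=
  forall (theta : nat -> term L) M (rho : nat -> M),
  C term_structure theta -> C M (eval rho \o theta).

Definition most_general (C : constraint) (theta : nat -> term L) :=
  C term_structure theta /\
  forall M (rho : nat -> M), FEA_model M -> C M rho ->
    exists rho', rho = eval rho' \o theta.

(** Constraints are solved in sequence: [theta2] solves what remains of [C2] after [theta1],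
    stability keeps [C1] true under [theta2], and the two factorizations compose. *)
Lemma most_general_and (C1 C2 : constraint) (theta1 theta2 : nat -> term L) :
  hom_stable C1 -> most_general C1 theta1 ->
  most_general (fun M rho => C2 M (eval rho \o theta1)) theta2 ->
  most_general (fun M rho => C1 M rho /\ C2 M rho) (subst theta2 \o theta1).
Proof.
move=> stable1 [sol1 gen1] [sol2 gen2]; split.
  by split=> //; apply: stable1.
move=> M rho HM [/(gen1 M rho HM) [rho' ->] /(gen2 M rho' HM) [rho'' ->]].
exists rho''; apply: functional_extensionality => x /=.
by rewrite eval_subst.
Qed.

Lemma hom_stable_sat F : Eformula F -> hom_stable (fun M rho => sat rho F).
Proof.
move=> EF theta M rho.
elim: F EF theta => //= [s t _|G IHG H IHH|x G IH] => [|/andP[EG EH]|EG] theta.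
- by rewrite -!eval_subst => ->.
- by case=> /(IHG EG) ? /(IHH EH).
(* The witness in [M] is the image of the witness term. *)
- case=> t /(IH EG) satG; exists (eval rho t).
  suff <- : eval rho \o @update _ term_structure theta x t =
    update (eval rho \o theta) x (eval rho t) by [].
  by apply: functional_extensionality => y; rewrite /update /=; case: eqP.
Qed.

(** * Unification *)

Definition vars_in (S : seq nat) t := forall x, occurs x t -> x \in S.

(* Termination of unification: a nontrivial step eliminates a variable. *)
Definition reduces (theta : nat -> term L) (S S' : seq nat) :=
  (theta = Var /\ S' = S) \/
  (size S' < size S /\ forall t, vars_in S t -> vars_in S' (subst theta t)).

(** A solution in a single model [M0] of FEA replaces the failure cases of unification: it excludes
    clashes of symbols and failed occurs checks. *)
Definition unifier_in (S : seq nat) (C : constraint) :=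
  forall M0 (rho0 : nat -> M0), FEA_model M0 -> C M0 rho0 ->
  exists theta S', most_general C theta /\ reduces theta S S'.

Definition eq_constraint s t : constraint :=
  fun M rho => eval rho s = eval rho t.

Lemma reduces_vars_in theta S S' t :
  reduces theta S S' -> vars_in S t -> vars_in S' (subst theta t).
Proof. by case=> [[-> ->]|[_]]; [rewrite subst_Var | apply]. Qed.

Lemma reduces_trans theta1 theta2 S1 S2 S3 :
  reduces theta1 S1 S2 -> reduces theta2 S2 S3 ->
  reduces (subst theta2 \o theta1) S1 S3.
Proof.
move=> [[-> ->]|[lt12 H12]] red23 //.
right; split.
  by case: red23 => [[_ ->]|[lt23 _]] //; apply: ltn_trans lt12.
move=> t /H12 /(reduces_vars_in red23).
by rewrite eval_subst.
Qed.

Lemma eq_unifier_in S (C C' : constraint) :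
  (forall M rho, C M rho <-> C' M rho) -> unifier_in S C -> unifier_in S C'.
Proof.
move=> eqC HC M0 rho0 HM0 /eqC /(HC _ _ HM0) [theta [S' [[sol gen] red]]].
exists theta, S'; split=> //; split; first exact/eqC.
by move=> M rho HM /eqC; apply: gen.
Qed.

(** Unless [t] is [Var x], the unifier binds [x] to [t]. The given solution guarantees the occurs
    check, so the binding leaves [t] fixed, and every solution factors through the binding with
    itself as the new assignment. *)
Lemma unifier_in_Var S x t :
  x \in S -> vars_in S t -> unifier_in S (eq_constraint (Var x) t).
Proof.
move=> xS tS M0 rho0 HM0 eq0; case: (classic (t = Var x)) => [->|tx].
  exists Var, S; split; [split=> // M rho _ _|by left].
  by exists rho.
have xt := FEA_model_occurs HM0 tx eq0.
pose theta y := if y == x then t else Var y.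
exists theta, [seq y <- S | y != x]; split.
  split=> [|M rho HM eq_xt].
    rewrite /eq_constraint /= /theta eqxx -[LHS]subst_Var.
    apply: (@eq_eval term_structure) => y yt; case: eqP => // yx.
    by rewrite -yx yt in xt.
  exists rho; apply: functional_extensionality => y /=.
  by rewrite /theta; case: eqP => // ->.
right; split.
  (* The list shrinks because [x] is listed in [S] at least once. *)
  by rewrite size_filter -(count_predC (pred1 x)) addnC -addn1 leq_add2l
    -has_count has_pred1.
move=> u uS y /occurs_subst [z zu]; rewrite /theta mem_filter.
case: eqP => [_ yt|zx /= /eqP ->].
  by rewrite tS // andbT; apply: contraNneq xt => <-.
by rewrite uS // andbT; apply/eqP.
Qed.

(** The equations are solved one by one, each solution being applied to the remaining ones. The two
    hypotheses on solvability are the inner and outer induction hypotheses of the unification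
    proof. *)
Lemma unifier_in_seq (I : eqType) (r : seq I) S (a b : I -> term L) :
  (forall i, i \in r -> unifier_in S (eq_constraint (a i) (b i))) ->
  (forall S' s t, size S' < size S -> vars_in S' s -> vars_in S' t ->
     unifier_in S' (eq_constraint s t)) ->
  (forall i, i \in r -> vars_in S (a i) /\ vars_in S (b i)) ->
  unifier_in S (fun M rho =>
    forall i, i \in r -> eval rho (a i) = eval rho (b i)).
Proof.
elim: r S a b => [|i r IH] S a b Hr Hlt abS M0 rho0 HM0 eq0.
  exists Var, S; split; [split=> // M rho _ _|by left].
  by exists rho.
have ir : i \in i :: r by rewrite inE eqxx.
have rr j : j \in r -> j \in i :: r by rewrite inE orbC => ->.
have [theta [S1 [mg1 red1]]] := Hr i ir M0 rho0 HM0 (eq0 i ir).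
have [rho1 def_rho0] := mg1.2 _ _ HM0 (eq0 i ir).
have [||||theta' [S2 [mg2 red2]]] :=
    IH S1 (subst theta \o a) (subst theta \o b) _ _ _ M0 rho1 HM0.
- move=> j jr /=; have [aS bS] := abS j (rr _ jr).
  (* A trivial first step leaves the other equations unchanged, so [Hr] still applies; a nontrivial
     one has eliminated a variable, so [Hlt] applies to the instantiated equations. *)
  case: (red1) => [[-> ->]|[lt1 _]].
    by rewrite !subst_Var; apply/Hr/rr.
  by apply: Hlt => //; apply: reduces_vars_in red1 _.
- move=> S' s t lt'; apply: Hlt.
  by case: red1 => [[_ <-]|[lt1 _]] //; apply: ltn_trans lt1.
- by move=> j /rr /abS [aS bS]; split; apply: reduces_vars_in red1 _.
- by move=> j jr /=; rewrite !eval_subst -def_rho0; apply/eq0/rr.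
exists (subst theta' \o theta), S2; split; last exact: reduces_trans red2.
have [] := @most_general_and (eq_constraint (a i) (b i))
  (fun M rho => forall j, j \in r -> eval rho (a j) = eval rho (b j))
  theta theta' _ mg1.
- by move=> eta M rho; rewrite /eq_constraint -!eval_subst => ->.
- case: mg2 => sol2 gen2; split=> [j jr|M rho HM eqr].
    by rewrite -!eval_subst; apply: sol2.
  by apply: gen2 => // j jr /=; rewrite !eval_subst; apply: eqr.
move=> [soli solr] gen; split=> [j|M rho HM eqr].
  by rewrite inE => /orP[/eqP->|/solr].
by apply: gen => //; split=> [|j /rr]; apply: eqr.
Qed.

(** Lexicographic induction on the length of [S] and then on the term [s]: decomposing two
    applications passes to the arguments of [s], and instantiation by a nontrivial solution shortens
    [S]. *)
Lemma unifier_in_eq S s t :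
  vars_in S s -> vars_in S t -> unifier_in S (eq_constraint s t).
Proof.
have [n] := ubnP (size S); elim: n S s t => // n IHn S s t.
rewrite ltnS => leSn.
elim/nested_term_ind: s t => [x|f a IHa] t sS tS.
  by apply: unifier_in_Var => //; apply: sS; rewrite /= eqxx.
case: t tS => [y|g b] tS.
  apply: (@eq_unifier_in _ (eq_constraint (Var y) (App f a))).
    by move=> M rho; split=> /esym.
  by apply: unifier_in_Var => //; apply: tS; rewrite /= eqxx.
move=> M0 rho0 HM0 eq0; have fg := FEA_model_clash HM0 eq0.
case: g / fg b tS eq0 => b tS eq0; move: M0 rho0 HM0 eq0.
have aS i : vars_in S (a i).
  by move=> x xa; apply: sS; apply/existsP; exists i.
have bS i : vars_in S (b i).
  by move=> x xb; apply: tS; apply/existsP; exists i.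
(* Injectivity of [f] holds only in models of FEA, so [eq_unifier_in] does not
   apply here. *)
have HU := @unifier_in_seq _ (enum 'I_(fun_arity f)) S a b
  (fun i _ => IHa i (b i) (aS i) (bS i))
  (fun S' s t lt => IHn S' s t (leq_trans lt leSn))
  (fun i _ => conj (aS i) (bS i)).
have decomp M (rho : nat -> M) : FEA_model M ->
    eq_constraint (App f a) (App f b) rho ->
    forall i, i \in enum 'I_(fun_arity f) -> eval rho (a i) = eval rho (b i).
  move=> HM /(FEA_model_inj HM)/ffunP eq_ab i _.
  by have := eq_ab i; rewrite !ffunE.
move=> M0 rho0 HM0 /(decomp _ _ HM0) /(HU _ _ HM0) [theta [S' [[sol gen] red]]].
exists theta, S'; split=> //.
split=> [|M rho HM /(decomp _ _ HM)]; last exact: gen.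
rewrite /eq_constraint /=; congr App; apply/ffunP => i; rewrite !ffunE.
by apply: sol; rewrite mem_enum.
Qed.

Lemma vars_in_exists t : exists S, vars_in S t.
Proof.
elim/nested_term_ind: t => [x|f a IH].
  by exists [:: x] => y /=; rewrite inE.
have [S HS] := fin_all_exists IH.
exists (flatten [seq S i | i <- enum 'I_(fun_arity f)]) => x /existsP [i xai].
by apply/flatten_mapP; exists i; [rewrite mem_enum | apply: HS].
Qed.

(** * Most general solutions of equations and E-formulas *)

Lemma most_general_eq s t M0 (rho0 : nat -> M0) :
  FEA_model M0 -> eval rho0 s = eval rho0 t ->
  exists theta, most_general (eq_constraint s t) theta.
Proof.
move=> HM0 eq0.
have [[S1 sS1] [S2 tS2]] := (vars_in_exists s, vars_in_exists t).
have [||theta [_ [mg _]]] := @unifier_in_eq (S1 ++ S2) s t _ _ _ _ HM0 eq0.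
- by move=> x /sS1; rewrite mem_cat => ->.
- by move=> x /tS2; rewrite mem_cat orbC => ->.
by exists theta.
Qed.

(* The parameter [sigma] is for the induction: the second conjunct is solved
   after instantiation by the solution of the first. *)
Lemma most_general_sat F (sigma : nat -> term L) M0 (rho0 : nat -> M0) :
  Eformula F -> FEA_model M0 -> sat (eval rho0 \o sigma) F ->
  exists theta, most_general (fun M rho => sat (eval rho \o sigma) F) theta.
Proof.
move=> EF HM0.
elim: F EF sigma rho0 => //= [_|s t _|G IHG H IHH|x G IH]
  => [||/andP[EG EH]|EG] sigma rho0.
- by exists Var; split=> // M rho _ _; exists rho.
- rewrite -!eval_subst => /(most_general_eq HM0) [theta [sol gen]].
  exists theta; split=> [|M rho HM]; first by rewrite /= -!eval_subst.
  by rewrite /= -!eval_subst; apply: gen.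
- case=> satG satH; have [theta1 mg1] := IHG EG _ _ satG.
  (* The factor [rho1] of [rho0] through [theta1] shows that the instantiated second conjunct is
     still solvable. *)
  have [rho1 def_rho0] := mg1.2 _ _ HM0 satG.
  have comp M (rho : nat -> M) :
      eval (eval rho \o theta1) \o sigma = eval rho \o (subst theta1 \o sigma).
    by apply: functional_extensionality => y /=; rewrite eval_subst.
  have [|theta2 mg2] := IHH EH (subst theta1 \o sigma) rho1.
    by rewrite -comp -def_rho0.
  exists (subst theta2 \o theta1).
  apply: (@most_general_and (fun M rho => sat (eval rho \o sigma) G)
            (fun M rho => sat (eval rho \o sigma) H)) => //.
    move=> eta M rho /(hom_stable_sat EG rho).
    suff -> : eval (eval rho \o eta) \o sigma =
      eval rho \o (subst eta \o sigma) by [].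
    by apply: functional_extensionality => y /=; rewrite eval_subst.
  case: mg2 => sol2 gen2; split=> [|M rho HM]; rewrite comp //.
  exact: gen2.
(* Shifting the variables of [sigma] makes [Var 0] fresh for the witness. *)
pose sigma' y := if y == x then Var 0 else subst (fun z => Var z.+1) (sigma y).
have evalE M (rho : nat -> M) :
    eval rho \o sigma' = update (eval (rho \o succn) \o sigma) x (rho 0).
  apply: functional_extensionality => y; rewrite /sigma' /update /=.
  by case: eqP => // _; rewrite eval_subst.
(* Matching the shift, [cons] stores the witness at variable 0 and moves [rho] up by one. *)
pose cons M (m : M) (rho : nat -> M) k := if k is k'.+1 then rho k' else m.
have evalS M (m : M) rho :
    eval (cons M m rho) \o sigma' = update (eval rho \o sigma) x m.
  by rewrite evalE.
case=> m satG; have [|theta [sol gen]] := IH EG sigma' (cons _ m rho0).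
  by rewrite evalS.
(* Undoing the shift: [theta 0] becomes the witness term, and the other values form the solution. *)
exists (theta \o succn); split.
  by exists (theta 0); rewrite -(evalE term_structure).
move=> M rho HM [m' satG'].
have [|rho' def_rho] := gen M (cons _ m' rho) HM; first by rewrite evalS.
by exists rho'; apply: functional_extensionality => y;
  have := congr1 (fun h => h y.+1) def_rho.
Qed.

(** * The disjunction property *)

Lemma Eformula_disjunction_property (I : eqType) (r : seq I) E
    (F : I -> formula L) :
  Eformula E -> (forall i, Eformula (F i)) -> r != [::] ->
  preceq E (bigdisj [seq F i | i <- r]) -> exists2 i, i \in r & preceq E (F i).
Proof.
move=> EE EF r0 leEF.
case: (classic (exists M0 (rho0 : nat -> M0), FEA_model M0 /\ sat rho0 E)).
  move=> [M0 [rho0 [HM0 sat0]]].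
  have [theta [sol gen]] := most_general_sat (sigma := Var) EE HM0 sat0.
  (* The disjunct is chosen once, in the term algebra, and then serves for all models and
     assignments. *)
  have /sat_bigdisj [i ir satF] := leEF _ FEA_model_term theta sol.
  exists i => // M HM rho satE.
  have [rho' ->] := gen M rho HM satE.
  exact: hom_stable_sat.
(* Without a solution in any model of FEA, [E] implies the first disjunct vacuously; one exists
   because [r] is nonempty. *)
move=> unsat; case: r r0 leEF => // i r _ _.
exists i; first by rewrite inE eqxx.
by move=> M HM rho satE; case: unsat; exists M, rho.
Qed.

End TermAlgebra.

Theorem theorem5p6 (L : language)
    (hL : exists c : funsym L, fun_arity c = 0)
    (n : nat) (hn : 1 <= n)
    (E : formula L) (hE : Eformula E)
    (E_ : 'I_n -> formula L) (hE_ : forall j : 'I_n, Eformula (E_ j)) :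
  ((forall j : 'I_n, prec (E_ j) E) ->
     prec (bigdisj [seq E_ j | j <- enum 'I_n]) E) /\
  (approx E (bigdisj [seq E_ j | j <- enum 'I_n]) ->
     exists j : 'I_n, approx E (E_ j)) /\
  (preceq E (bigdisj [seq E_ j | j <- enum 'I_n]) ->
     exists j : 'I_n, preceq E (E_ j)).
Proof.
set D := bigdisj _.
(* The other two parts reduce to this one. *)
have part3 : preceq E D -> exists j, preceq E (E_ j).
  case/Eformula_disjunction_property=> // [|j _ leEj]; last by exists j.
  by rewrite -size_eq0 size_enum_ord -lt0n.
have leD j : preceq (E_ j) D.
  by move=> M HM rho satEj; apply/sat_bigdisj; exists j; rewrite ?mem_enum.
split; [|split=> //].
  move=> ltE; split=> [M HM rho /sat_bigdisj [j _ satEj]|eqDE].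
    by have [leE _] := ltE j; apply: (leE M HM rho).
  (* If [D] were equivalent to [E], then [E] would imply some [E_ j], making that [E_ j] equivalent
     to [E] against strictness. *)
  have [|j leEj] := part3; first by move=> M HM rho /(eqDE M HM rho).
  have [leE []] := ltE j => M HM rho.
  by split; [apply: (leE M HM rho) | apply: (leEj M HM rho)].
move=> eqED; have [|j leEj] := part3; first by move=> M HM rho /(eqED M HM rho).
exists j => M HM rho; split; first exact: (leEj M HM rho).
by move=> /(leD j M HM rho) /(eqED M HM rho).
Qed.
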